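(* Let $\alpha\ge1$, $0<\sigma<s$, $p\ge1$, and let $K=\mathbb{T}^{m_1}\times\bar B$, $L=\mathbb{T}^{m_1}\times\bar B'$ be compact sets, where $B,B'$ are open subsets of $\mathbb{R}^{m_2}$. Let $f\in G_{\alpha,s}(K,\mathbb{R}^p)$ and let $g\in G_{\alpha,s-\sigma}(L,\mathbb{T}^{m_1}\times\mathbb{R}^{m_2})$ be such that $g(L)\subseteq K$. Assume that $g=\mathrm{Id}+u$ with $$|u|_{\alpha,s-\sigma}\le\sigma^\alpha.$$ Then $f\circ g\in G_{\alpha,s-\sigma}(L,\mathbb{R}^p)$ and $$|f\circ g|_{\alpha,s-\sigma}\le|f|_{\alpha,s}.$$
   Context: $\mathbb{T}^{m_1}=\mathbb{R}^{m_1}/\mathbb{Z}^{m_1}$, $m=m_1+m_2$. For a compact set $K$ of the form $K=\mathbb{T}^{m_1}\times\bar B$, where $\bar B$ is the closure of an open subset $B$ of $\mathbb{R}^{m_2}$, and $f:K\to\mathbb{R}^p$ smooth (extending smoothly to an open neighbourhood of $K$), $$|f|_{\alpha,s}:=\frac{4\pi^2}{3}\sup_{a\in K}\ \sup_{k\in\mathbb{N}^m}\frac{(|k|+1)^2s^{\alpha|k|}|\partial^kf(a)|}{|k|!^\alpha},\qquad |\partial^kf(a)|=\sum_{i=1}^p|\partial^kf_i(a)|,$$ with $|k|=k_1+\dots+k_m$; $G_{\alpha,s}(K,\mathbb{R}^p)$ is the Banach space of such $f$ with $|f|_{\alpha,s}<\infty$. For a torus-valued map $g=\mathrm{Id}+u$,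 $u$ is regarded as an $\mathbb{R}^{m}$-valued function on $L$. *)

(* Defs.v *)
From HB Require Import structures.
From mathcomp Require Import all_boot all_order all_algebra.
From mathcomp Require Import all_classical all_reals all_analysis.

Set Implicit Arguments.
Unset Strict Implicit.
Unset Printing Implicit Defensive.

Import Order.TTheory GRing.Theory Num.Theory.
Import numFieldNormedType.Exports.

Local Open Scope classical_set_scope.
Local Open Scope ring_scope.

Section Torus.
Variables (R : realType) (m1 : nat).

Definition int_cong (x y : 'rV[R]_m1) : bool :=
  [forall i, x 0 i - y 0 i \is a Num.int].

Lemma int_cong_equiv : equiv_class_of int_cong.
Proof.
split => [x|x y|y x z].
- by apply/forallP => i; rewrite subrr rpred0.
- by apply: eq_forallb => i; rewrite -opprB rpredN.
- move=> /forallP xy /forallP yz; apply/forallP => i.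
  by rewrite -(subrK (y 0 i) (x 0 i)) -addrA rpredD.
Qed.

Canonical int_cong_equiv_rel := EquivRelPack int_cong_equiv.

Definition torus := quotient_topology {eq_quot int_cong}%qT.

Definition torus_pi (x : 'rV[R]_m1) : torus := \pi_torus%qT x.

End Torus.

Section Cylinder.
Variables (R : realType) (m1 m2 : nat).

Local Notation X := (torus R m1 * 'rV[R]_m2)%type.

(* the universal covering of T^m1 x R^m2 *)
Definition cover (x : 'rV[R]_(m1 + m2)) : X :=
  (torus_pi (lsubmx x), rsubmx x).

Definition cover_repr (a : X) : 'rV[R]_(m1 + m2) :=
  row_mx (repr a.1) a.2.

Lemma cover_reprK : cancel cover_repr cover.
Proof.
by case=> t y; rewrite /cover /cover_repr row_mxKl row_mxKr /torus_pi reprK.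
Qed.

(* T^m1 x A *)
Definition cyl (A : set 'rV[R]_m2) : set X := [set a | A a.2].

End Cylinder.

Arguments cyl {R} m1 {m2} A.

Section PartialDerivatives.
Variables (R : realType) (m : nat).

Definition partial (i : 'I_m) (h : 'rV[R]_m -> R) : 'rV[R]_m -> R :=
  fun x => 'D_(delta_mx 0 i) h x.

Definition partials (l : seq 'I_m) (h : 'rV[R]_m -> R) : 'rV[R]_m -> R :=
  foldr partial h l.

Definition mdeg (k : {ffun 'I_m -> nat}) : nat := (\sum_i k i)%N.

(* d^k h = d_0^(k 0) ... d_(m-1)^(k (m-1)) h *)
Definition mpartial (k : {ffun 'I_m -> nat}) (h : 'rV[R]_m -> R) :=
  partials (flatten [seq nseq (k i) i | i <- enum 'I_m]) h.

End PartialDerivatives.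

Section Gevrey.
Variables (R : realType) (m1 m2 : nat).
Local Notation X := (torus R m1 * 'rV[R]_m2)%type.

Definition lift_coord (p : nat) (F : X -> 'rV[R]_p) (j : 'I_p) :
    'rV[R]_(m1 + m2) -> R :=
  fun x => F (cover x) 0 j.

(* F is C^oo on the open set U: its iterated partial derivatives, in any order,
   are Frechet-differentiable on U *)
Definition smooth_on (p : nat) (U : set X) (F : X -> 'rV[R]_p) :=
  forall (j : 'I_p) (l : seq 'I_(m1 + m2)) (x : 'rV[R]_(m1 + m2)),
    U (cover x) -> differentiable (partials l (lift_coord F j)) x.

(* A function on K is given by a total function whose values outside K are
   irrelevant. *)
Definition smooth_extension (p : nat) (K : set X) (f F : X -> 'rV[R]_p) :=
  exists U : set X,
    [/\ open U, K `<=` U, smooth_on U F & {in K, F =1 f}].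

Definition smooth (p : nat) (K : set X) (f : X -> 'rV[R]_p) :=
  exists F, smooth_extension K f F.

(* (d^k f_j)(a) for a in K, computed on some smooth extension of f; when K is
   T^m1 times the closure of an open set, the choice of the extension is
   irrelevant, see dpart_ext below. *)
Definition dpart (p : nat) (K : set X) (f : X -> 'rV[R]_p)
    (k : {ffun 'I_(m1 + m2) -> nat}) (j : 'I_p) (a : X) : R :=
  mpartial k (lift_coord (xget f (smooth_extension K f)) j) (cover_repr a).

Definition dnorm (p : nat) (K : set X) (f : X -> 'rV[R]_p)
    (k : {ffun 'I_(m1 + m2) -> nat}) (a : X) : R :=
  \sum_(j < p) `|dpart K f k j a|.

Definition gevrey_norm (alpha s : R) (p : nat) (K : set X)
    (f : X -> 'rV[R]_p) : \bar R :=
  ((4 * pi ^+ 2 / 3)%:E *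
   ereal_sup [set ereal_sup
     [set (((mdeg k).+1%:R ^+ 2 * s `^ (alpha * (mdeg k)%:R) * dnorm K f k a)
           / ((mdeg k)`!%:R `^ alpha))%:E
     | k in [set: {ffun 'I_(m1 + m2) -> nat}]]
   | a in K])%E.

Definition gevrey (alpha s : R) (p : nat) (K : set X) (f : X -> 'rV[R]_p) :=
  smooth K f /\ (gevrey_norm alpha s K f < +oo)%E.

(* g = Id + u on L, where u takes its values in R^m *)
Definition Id_plus (L : set X) (u : X -> 'rV[R]_(m1 + m2)) (g : X -> X) :=
  forall x, L (cover x) -> g (cover x) = cover (x + u (cover x)).

End Gevrey.

Section Extension.
Variables (R : realType) (m1 m2 : nat).
Local Notation X := (torus R m1 * 'rV[R]_m2)%type.

Lemma near_partials (m : nat) (l : seq 'I_m) (h1 h2 : 'rV[R]_m -> R)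
    (x : 'rV[R]_m) :
  (\forall y \near x, h1 y = h2 y) ->
  \forall y \near x, partials l h1 y = partials l h2 y.
Proof.
move=> h12; elim: l => //= i l IHl.
by apply: filterS (near_join IHl) => y; exact: near_eq_derive.
Qed.

Lemma partials_shift (m : nat) (l : seq 'I_m) (h : 'rV[R]_m -> R) v x :
  (forall y, h (y + v) = h y) -> partials l h (x + v) = partials l h x.
Proof.
move=> hv; elim: l x => [|i l IHl] x /=; first exact: hv.
rewrite /partial /derive IHl.
have -> : (partials l h \o shift (x + v)) = (partials l h \o shift x).
  by apply/funext => t /=; rewrite addrA IHl.
by [].
Qed.

Lemma cover_eqP (x y : 'rV[R]_(m1 + m2)) :
  cover x = cover y ->
  forall z : 'rV[R]_(m1 + m2), cover (z + (x - y)) = cover z.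
Proof.
case=> /eqmodP/forallP xy rxy z; rewrite /cover !linearD !linearN /= rxy subrr.
rewrite addr0; congr (_, _); apply/eqmodP/forallP => i.
by rewrite !mxE [X in X - _]addrC addrK; have := xy i; rewrite !mxE.
Qed.

Lemma partials_cover (p : nat) (F : X -> 'rV[R]_p) j l x y :
  cover x = cover y ->
  partials l (lift_coord F j) x = partials l (lift_coord F j) y.
Proof.
move=> xy; rewrite -{1}(subrK y x) addrC; apply: partials_shift => z.
by rewrite /lift_coord (cover_eqP xy).
Qed.

Lemma smooth_extension_partials (p : nat) (B : set 'rV[R]_m2)
    (f F1 F2 : X -> 'rV[R]_p) j l (x : 'rV[R]_(m1 + m2)) :
  open B -> smooth_extension (cyl m1 (closure B)) f F1 ->
  smooth_extension (cyl m1 (closure B)) f F2 ->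
  cyl m1 (closure B) (cover x) ->
  partials l (lift_coord F1 j) x = partials l (lift_coord F2 j) x.
Proof.
move=> oB [U1 [oU1 KU1 sF1 F1f]] [U2 [oU2 KU2 sF2 F2f]] Kx.
have inside y : B (rsubmx y) ->
    partials l (lift_coord F1 j) y = partials l (lift_coord F2 j) y.
  move=> By; apply: (nbhs_singleton (near_partials l _)).
  have : \forall z \near y, B (rsubmx z).
    exact: (@continuous_rsubmx R 1 m1 m2 y _ (open_nbhs_nbhs (conj oB By))).
  apply: filterS => z Bz.
  have Kz : cover z \in cyl m1 (closure B).
    by rewrite inE; exact: subset_closure.
  by rewrite /lift_coord F1f// F2f.
have c1 := differentiable_continuous (sF1 j l x (KU1 _ Kx)).
have c2 := differentiable_continuous (sF2 j l x (KU2 _ Kx)).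
apply/eqP; rewrite -subr_eq0; apply/negPn/negP => d0.
have dc : {for x, continuous (fun y => partials l (lift_coord F1 j) y
                                     - partials l (lift_coord F2 j) y)}.
  exact: (continuousB c1 c2).
have nx : \forall y \near x,
      partials l (lift_coord F1 j) y - partials l (lift_coord F2 j) y != 0.
  apply: (dc [set r | r != 0]).
  exact: open_nbhs_nbhs (conj (@open_neq R 0) d0).
have rc : (fun y : 'rV[R]_m2 => row_mx (lsubmx x) y) y @[y --> rsubmx x] --> x.
  move=> A [P nP PA]; exists (fun i j => P i (rshift m1 j)) => [a b|y Py].
    by rewrite /= mxE; exact: nP.
  apply: PA => a b; rewrite -[b]splitK; case: (fintype.split b) => c /=.
    by rewrite row_mxEl mxE; exact: nbhs_singleton.
  by rewrite row_mxEr; exact: Py.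
have [y [By]] := Kx _ (rc _ nx).
by rewrite /= inside ?row_mxKr// subrr eqxx.
Qed.

Lemma dpart_ext (p : nat) (B : set 'rV[R]_m2) (f F : X -> 'rV[R]_p) k j
    (x : 'rV[R]_(m1 + m2)) :
  open B -> smooth_extension (cyl m1 (closure B)) f F ->
  cyl m1 (closure B) (cover x) ->
  dpart (cyl m1 (closure B)) f k j (cover x) = mpartial k (lift_coord F j) x.
Proof.
move=> oB fF Kx; rewrite /dpart /mpartial (@partials_cover _ _ _ _ _ x).
  apply: (smooth_extension_partials _ _ oB _ fF Kx).
  by apply: xgetPex; exists F.
exact: cover_reprK.
Qed.

End Extension.

(* Main.v *)
(** Near a point x of L the lift of f o g is F o G, with F and G = Id + v smooth
    extensions on the universal cover.  Iterating the chain and Leibniz rules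
    (mixed partials commute), the l^1 norms of its partial derivatives of order
    n at x are dominated by the n-th derivative at 0 of a composition P o Q of
    one-variable polynomials, where P and Q carry the Gevrey bounds of F at G x
    and of G at x; the value v x drops out because only derivatives of G occur.
    Put S = s^alpha, tau = (s - sigma)^alpha, w = sigma^alpha, e_n = (n+1)^-2
    and c = 4 pi^2 / 3.  The inequality i! j_1! ... j_i! <= n! for positive
    j_1 + ... + j_i = n reduces the estimate of the coefficients of P o Q to
    alpha = 1, where e * e <= c e and tau + w <= S give, by induction on i, a
    bound of [t^n] (tau t + (w/c) sum_j e_j t^j)^i in terms of S^i and tau^i
    whose weighted sum over i is e_n. *)

Require Import Defs.
From mathcomp Require Import all_boot all_order all_algebra.
From mathcomp Require Import all_classical all_reals all_analysis.
From mathcomp Require Import ring lra.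
Import Order.TTheory GRing.Theory Num.Theory.
Import numFieldNormedType.Exports.
Import Defs.
Local Open Scope classical_set_scope.
Local Open Scope ring_scope.

Set Implicit Arguments.
Unset Strict Implicit.
Unset Printing Implicit Defensive.

(** * Symmetry of mixed derivatives *)

Lemma is_derive_line (R : realType) (V W : normedModType R) (f : V -> W)
    (x v : V) (r : R) :
  derivable f (x + r *: v) v ->
  is_derive r 1 (fun h => f (x + h *: v)) ('D_v f (x + r *: v)).
Proof.
have E : (fun h => h^-1 *: (((fun h => f (x + h *: v)) \o shift r) (h *: 1)
                          - f (x + r *: v)))
       = (fun h => h^-1 *: ((f \o shift (x + r *: v)) (h *: v)
                          - f (x + r *: v))).
  apply/funext => h; congr (_ *: (f _ - _)) => /=.
  by rewrite [h *: 1]mulr1 scalerDl addrCA.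
by move=> df; apply: DeriveDef; rewrite /derivable /derive E.
Qed.

(** The mean value theorem is applied twice: along [v] to the increment of [f] under [t *: w], then
    along [w] to ['D_v f]. *)
Lemma second_difference (R : realType) (V : normedModType R) (f : V -> R)
    (x v w : V) (t : R) : 0 <= t ->
  (forall a b, 0 <= a <= t -> 0 <= b <= t ->
     derivable f (x + b *: w + a *: v) v /\
     derivable ('D_v f) (x + a *: v + b *: w) w) ->
  exists a b, [/\ 0 <= a <= t, 0 <= b <= t &
    f (x + t *: w + t *: v) - f (x + t *: w) - (f (x + t *: v) - f x)
    = 'D_w ('D_v f) (x + a *: v + b *: w) * t * t].
Proof.
move=> t0 df.
have tt : 0 <= t <= t by rewrite t0 lexx.
have t00 : 0 <= (0 : R) <= t by rewrite t0 lexx.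
have D a : 0 <= a <= t -> is_derive a 1
    (fun a => f (x + t *: w + a *: v) - f (x + a *: v))
    ('D_v f (x + t *: w + a *: v) - 'D_v f (x + a *: v)).
  move=> a01; apply: is_deriveB; apply: is_derive_line.
    exact: (df a t a01 tt).1.
  by have [+ _] := df a 0 a01 t00; rewrite scale0r addr0.
have [||a /[!in_itv]/= a01] :=
    @MVT_segment _ (fun a => f (x + t *: w + a *: v) - f (x + a *: v))
      (fun a => 'D_v f (x + t *: w + a *: v) - 'D_v f (x + a *: v)) 0 t t0.
- by move=> a /[!in_itv]/= /andP[a0 a1]; apply: D; rewrite !ltW.
- apply: derivable_within_continuous => a /[!in_itv]/= a01.
  by have [] := D _ a01.
rewrite !scale0r !addr0 subr0 => Ea.
have Dw b : 0 <= b <= t -> is_derive b 1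
    (fun b => 'D_v f (x + a *: v + b *: w))
    ('D_w ('D_v f) (x + a *: v + b *: w)).
  by move=> b01; apply: is_derive_line; exact: (df a b a01 b01).2.
have [||b /[!in_itv]/= b01] :=
    @MVT_segment _ (fun b => 'D_v f (x + a *: v + b *: w))
      (fun b => 'D_w ('D_v f) (x + a *: v + b *: w)) 0 t t0.
- by move=> b /[!in_itv]/= /andP[b0 b1]; apply: Dw; rewrite !ltW.
- apply: derivable_within_continuous => b /[!in_itv]/= b01.
  by have [] := Dw _ b01.
rewrite scale0r addr0 subr0 => Eb.
exists a, b; split => //.
transitivity (('D_v f (x + a *: v + t *: w) - 'D_v f (x + a *: v)) * t).
  by rewrite (addrAC x (a *: v)) -Ea; ring.
by rewrite Eb.
Qed.

Lemma near_square (R : realType) (V : normedModType R) (x v w : V)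
    (P : set V) : nbhs x P ->
  exists2 t, 0 < t & forall a b, 0 <= a <= t -> 0 <= b <= t ->
    P (x + a *: v + b *: w).
Proof.
move=> /nbhs_ballP[e /= e0 eP].
have n0 : 0 < `|v| + `|w| + 1 by rewrite ltr_wpDl.
(* The 1 keeps the denominator positive when [v] and [w] vanish; the 2 makes the last inequality
   strict. *)
exists (e / (`|v| + `|w| + 1) / 2) => [|a b /andP[a0 a1] /andP[b0 b1]].
  by rewrite !divr_gt0.
apply: eP; rewrite -ball_normE /= -addrA opprD addNKr normrN.
set t := e / _ / 2 in a1 b1.
apply: (@le_lt_trans _ _ (t * `|v| + t * `|w|)).
  rewrite (le_trans (ler_normD _ _))// !normrZ !ger0_norm//.
  by rewrite lerD// ler_wpM2r.
have t0 : 0 < t by rewrite !divr_gt0.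
rewrite -mulrDr (@le_lt_trans _ _ (t * (`|v| + `|w| + 1)))//.
  by rewrite ler_pM2l// lerDl.
by rewrite /t mulrAC divfK ?gt_eqF// ltr_pdivrMr// ltr_pMr// ltr1n.
Qed.

(** The second difference over a small square is symmetric in [v] and [w], so both mixed derivatives
    take a common value, at two points of the square; continuity at [x] then excludes a gap. *)
Lemma derive_comm (R : realType) (V : normedModType R) (f : V -> R)
    (x v w : V) :
  (\forall y \near x, [/\ derivable f y v, derivable f y w,
     derivable ('D_v f) y w & derivable ('D_w f) y v]) ->
  {for x, continuous ('D_w ('D_v f))} -> {for x, continuous ('D_v ('D_w f))} ->
  'D_w ('D_v f) x = 'D_v ('D_w f) x.
Proof.
move=> df cvw cwv; apply: contrapT => /eqP neq.
have sep (p q r : R) :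
    `|p - r| < `|p - q| / 2 -> `|q - r| < `|p - q| / 2 -> False.
  move=> pr qr; have := ltrD pr qr; rewrite -splitr ltNge => /negP; apply.
  by rewrite (distrC q) ler_distD.
pose e := `|'D_w ('D_v f) x - 'D_v ('D_w f) x| / 2.
have e0 : 0 < e by rewrite divr_gt0// normr_gt0 subr_eq0.
move/cvgrPdist_lt: cvw => /(_ _ e0) cvw.
move/cvgrPdist_lt: cwv => /(_ _ e0) cwv.
have [t t0 sq] := near_square v w (filterI df (filterI cvw cwv)).
have [|a [b [a01 b01 Ea]]] := @second_difference _ _ f x v w t (ltW t0).
  move=> a b a01 b01; have [[d1 _ d2 _] _] := sq a b a01 b01.
  by split; [rewrite [x + b *: w + _]addrAC; exact: d1|exact: d2].
have [|c [d [c01 d01 Ec]]] := @second_difference _ _ f x w v t (ltW t0).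
  move=> c d c01 d01; have [[_ d1 _ d2] _] := sq d c d01 c01.
  by split; [exact: d1|rewrite [x + c *: w + _]addrAC; exact: d2].
have [_ [+ _]] := sq _ _ a01 b01; have [_ [_ +]] := sq _ _ d01 c01.
have -> : 'D_w ('D_v f) (x + a *: v + b *: w)
        = 'D_v ('D_w f) (x + d *: v + c *: w).
  rewrite [x + d *: v + _]addrAC.
  have tt0 : t * t != 0 by rewrite mulf_neq0// gt_eqF.
  have sw (p q r z : R) : p - q - (r - z) = p - r - (q - z) by ring.
  apply: (mulIf tt0); rewrite [LHS]mulrA [RHS]mulrA.
  apply: etrans (esym Ea) (etrans _ Ec).
  by rewrite [x + t *: v + _]addrAC; exact: sw.
move=> h1 h2; exact: (sep _ _ _ h2 h1).
Qed.

(** * Iterated partial derivatives of sums, products and compositions *)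

Lemma near_eq_differentiable (R : realType) (V W : normedModType R)
    (f g : V -> W) (x : V) :
  (\forall y \near x, f y = g y) -> differentiable f x -> differentiable g x.
Proof.
move=> fg df; have [dfc dfo] := (diff_locallyP _ _).1 df.
have go : g \o shift x = cst (g x) + 'd f x +o_ (0 : V) id.
  apply/eqaddoP => e e0; move/eqaddoP: dfo => /(_ e e0).
  have : \forall y \near (0 : V), f (y + x) = g (y + x).
    by move: fg; rewrite (near_shift 0)/= subr0.
  apply: filterS2 => y; rewrite /= -![(_ - _ : _ -> _) _]/(_ - _) /=.
  by rewrite -![(_ + _ : _ -> _) _]/(_ + _) /= (nbhs_singleton fg) => ->.
apply/diff_locallyP.
have -> : 'd g x = 'd f x :> (V -> W) by exact: diff_unique.
by split.
Qed.

Section PartialsOnOpen.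
Variables (R : realType) (m : nat).
Implicit Types (O : set 'rV[R]_m) (h f g : 'rV[R]_m -> R) (l : seq 'I_m).

(** The last index acts first. Inductions peel it off, since the sum, product and chain rules
    rewrite the innermost derivative. *)
Lemma partials_rcons l i h : partials (rcons l i) h = partials l (partial i h).
Proof. exact: foldr_rcons. Qed.

Lemma eq_on_partials O h1 h2 l x : open O -> (forall y, O y -> h1 y = h2 y) ->
  O x -> partials l h1 x = partials l h2 x.
Proof.
move=> oO h12 Ox; apply: (nbhs_singleton (near_partials l _)).
by apply: filterS (open_nbhs_nbhs (conj oO Ox)).
Qed.

(** Truncating smoothness at a finite order gives an induction variable: the derivative of a product
    or composition is a sum of products of functions known at the previous order. *)
Definition diff_upto (n : nat) O h :=
  forall l x, (size l <= n)%N -> O x -> differentiable (partials l h) x.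

Definition smooth_fun O h := forall n, diff_upto n O h.

Lemma diff_upto0 n O h x : diff_upto n O h -> O x -> differentiable h x.
Proof. by move=> dh; exact: (dh [::]). Qed.

Lemma diff_uptoS n O h : diff_upto n.+1 O h <->
  (forall x, O x -> differentiable h x) /\
  (forall i, diff_upto n O (partial i h)).
Proof.
split=> [dh|[dh dph] l x].
  split=> [x Ox|i l x ln Ox]; first exact: (dh [::]).
  by rewrite -partials_rcons; apply: dh; rewrite ?size_rcons.
case/lastP: l => [|l i] ln Ox; first exact: dh.
by rewrite partials_rcons; apply: dph; rewrite // size_rcons in ln *.
Qed.

Lemma diff_uptoW n O h : diff_upto n.+1 O h -> diff_upto n O h.
Proof. by move=> dh l x ln; apply: dh; exact: leqW. Qed.

Lemma eq_on_diff_upto n O f g : open O -> (forall x, O x -> f x = g x) ->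
  diff_upto n O f -> diff_upto n O g.
Proof.
move=> oO fg df l x ln Ox; apply: near_eq_differentiable (df _ _ ln Ox).
apply: near_partials; exact: filterS (open_nbhs_nbhs (conj oO Ox)).
Qed.

Lemma smooth_fun_partial O h i : smooth_fun O h -> smooth_fun O (partial i h).
Proof. by move=> sh n; have /diff_uptoS[] := sh n.+1. Qed.

Lemma partialD f g i x : differentiable f x -> differentiable g x ->
  partial i (fun y => f y + g y) x = partial i f x + partial i g x.
Proof. by move=> df dg; rewrite /partial deriveD//; exact: diff_derivable. Qed.

Lemma partialM f g i x : differentiable f x -> differentiable g x ->
  partial i (fun y => f y * g y) x = partial i f x * g x + f x * partial i g x.
Proof.
move=> df dg; rewrite /partial deriveM; [|exact: diff_derivable..].
by rewrite addrC; congr (_ + _); rewrite [LHS]mulrC.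
Qed.

Lemma partial_cst (i : 'I_m) (a : R) : partial i (fun=> a) = fun=> 0.
Proof. by apply/funext => x; rewrite /partial derive_cst. Qed.

Lemma diff_upto_cst n O (a : R) : diff_upto n O (fun=> a).
Proof.
elim: n a => [|n IHn] a; first by case=> // x _ _; exact: differentiable_cst.
apply/diff_uptoS; split=> [x _|i]; first exact: differentiable_cst.
by rewrite partial_cst.
Qed.

Lemma diff_uptoD n O f g : open O -> diff_upto n O f -> diff_upto n O g ->
  diff_upto n O (fun x => f x + g x).
Proof.
move=> oO; elim: n f g => [|n IHn] f g df dg.
  case=> // x _ Ox; apply: differentiableD.
    exact: diff_upto0 df Ox.
  exact: diff_upto0 dg Ox.
have [df0 dfp] := (diff_uptoS _ _ _).1 df.
have [dg0 dgp] := (diff_uptoS _ _ _).1 dg.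
apply/diff_uptoS; split=> [x Ox|i].
  by apply: differentiableD; [exact: df0|exact: dg0].
apply: (eq_on_diff_upto oO _ (IHn _ _ (dfp i) (dgp i))) => x Ox.
by rewrite partialD//; [exact: df0|exact: dg0].
Qed.

Lemma diff_uptoM n O f g : open O -> diff_upto n O f -> diff_upto n O g ->
  diff_upto n O (fun x => f x * g x).
Proof.
move=> oO; elim: n f g => [|n IHn] f g df dg.
  case=> // x _ Ox; apply: differentiableM.
    exact: diff_upto0 df Ox.
  exact: diff_upto0 dg Ox.
have [df0 dfp] := (diff_uptoS _ _ _).1 df.
have [dg0 dgp] := (diff_uptoS _ _ _).1 dg.
apply/diff_uptoS; split=> [x Ox|i].
  by apply: differentiableM; [exact: df0|exact: dg0].
have dfgi := diff_uptoD oO (IHn _ _ (dfp i) (diff_uptoW dg))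
                           (IHn _ _ (diff_uptoW df) (dgp i)).
apply: (eq_on_diff_upto oO _ dfgi) => x Ox.
by rewrite partialM//; [exact: df0|exact: dg0].
Qed.

Lemma diff_upto_sum n O k (F : 'I_k -> 'rV[R]_m -> R) : open O ->
  (forall q, diff_upto n O (F q)) -> diff_upto n O (fun x => \sum_q F q x).
Proof.
move=> oO dF.
have -> : (fun x => \sum_q F q x) = \sum_q F q.
  by apply/funext => x; rewrite fct_sumE.
apply: big_ind => [|f g|q _]; [exact: diff_upto_cst| |exact: dF].
exact: diff_uptoD.
Qed.

End PartialsOnOpen.

Lemma differentiable_row (R : realType) (V : normedModType R) (m : nat)
    (G : V -> 'rV[R]_m) (x : V) :
  (forall j, differentiable (fun y => G y 0 j) x) -> differentiable G x.
Proof.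
move=> dG.
have -> : G = \sum_(j < m) (fun y => G y 0 j *: delta_mx 0 j).
  by apply/funext => y; rewrite fct_sumE -row_sum_delta.
by apply: differentiable_sum => j; exact: differentiableZl.
Qed.

Section ChainRule.
Variables (R : realType) (n m : nat) (G : 'rV[R]_n -> 'rV[R]_m).

Lemma partial_comp (h : 'rV[R]_m -> R) i x :
  (forall j, differentiable (fun y => G y 0 j) x) ->
  differentiable h (G x) ->
  partial i (h \o G) x
  = \sum_j partial j h (G x) * partial i (fun y => G y 0 j) x.
Proof.
move=> dGj dh; have dG := differentiable_row dGj.
rewrite /partial deriveE; last exact: differentiable_comp.
have EG : 'd G x (delta_mx 0 i)
    = \row_j 'D_(delta_mx 0 i) (fun y => G y 0 j) x.
  rewrite -deriveE// derive_mx; last exact: diff_derivable.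
  by apply/rowP => j; rewrite !mxE.
rewrite diff_comp//= EG; set v := \row__ _; rewrite [v]row_sum_delta linear_sum.
apply: eq_bigr => j _; rewrite linearZ/= deriveE// mxE mulrC.
by [].
Qed.

Variables (O : set 'rV[R]_n) (P : set 'rV[R]_m).
Hypotheses (oO : open O) (GOP : forall x, O x -> P (G x)).
Hypothesis sG : forall j, smooth_fun O (fun x => G x 0 j).

Lemma eq_on_partial_comp (h : 'rV[R]_m -> R) i x : smooth_fun P h -> O x ->
  partial i (h \o G) x
  = \sum_j (partial j h \o G) x * partial i (fun y => G y 0 j) x.
Proof.
move=> sh Ox; apply: partial_comp => [j|]; first exact: diff_upto0 (@sG j 0) Ox.
exact: diff_upto0 (sh 0) (GOP Ox).
Qed.

(** By the chain rule, order [k.+1] for [h \o G] reduces to order [k] for each [partial j h \o G];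
    hence [h] stays general in the induction. *)
Lemma smooth_fun_comp (h : 'rV[R]_m -> R) :
  smooth_fun P h -> smooth_fun O (h \o G).
Proof.
move=> + k; elim: k h => [|k IHk] h sh.
  case=> // x _ Ox; apply: differentiable_comp; last first.
    exact: diff_upto0 (sh 0) (GOP Ox).
  by apply: differentiable_row => j; exact: diff_upto0 (@sG j 0) Ox.
apply/diff_uptoS; split=> [x Ox|i].
  exact: diff_upto0 (IHk _ sh) Ox.
have ds : diff_upto k O (fun x => \sum_j
    (partial j h \o G) x * partial i (fun y => G y 0 j) x).
  apply: diff_upto_sum => // j; apply: diff_uptoM => //.
    exact/IHk/smooth_fun_partial.
  exact: smooth_fun_partial.
apply: (eq_on_diff_upto oO _ ds) => x Ox.
by rewrite eq_on_partial_comp.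
Qed.

End ChainRule.

Section MixedPartials.
Variables (R : realType) (m : nat) (O : set 'rV[R]_m) (h : 'rV[R]_m -> R).
Hypotheses (oO : open O) (sh : smooth_fun O h).

Lemma partials_swap i j l x : O x ->
  partials [:: i, j & l] h x = partials [:: j, i & l] h x.
Proof.
move=> Ox /=; apply: derive_comm; last 2 first.
- exact: differentiable_continuous (sh (l := [:: i, j & l]) (leqnn _) Ox).
- exact: differentiable_continuous (sh (l := [:: j, i & l]) (leqnn _) Ox).
apply: filterS (open_nbhs_nbhs (conj oO Ox)) => y Oy.
split; apply: diff_derivable.
- exact: sh (leqnn _) Oy.
- exact: sh (leqnn _) Oy.
- exact: (sh (l := j :: l) (leqnn _) Oy).
- exact: (sh (l := i :: l) (leqnn _) Oy).
Qed.

Lemma perm_partials l1 l2 x : perm_eq l1 l2 -> O x ->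
  partials l1 h x = partials l2 h x.
Proof.
have front l i l' y : O y ->
    partials (l ++ i :: l') h y = partials (i :: l ++ l') h y.
  elim: l y => // j l IHl y Oy; rewrite -partials_swap//.
  exact: (@eq_on_partials _ _ O _ _ [:: j] y oO IHl).
elim: l1 l2 x => [|i l1 IHl1] l2 x.
  by rewrite perm_sym => /perm_nilP ->.
move=> p12 Ox; have il2 : i \in l2 by rewrite -(perm_mem p12) mem_head.
case/splitPr: il2 p12 => a b p12; rewrite front//.
have {}p12 : perm_eq l1 (a ++ b).
  by rewrite -(perm_cons i) (permPl p12) -cat1s perm_catCA.
apply: (@eq_on_partials _ _ O _ _ [:: i] x oO) => // y Oy; exact: IHl1.
Qed.

(** [l] is a permutation of the sorted list behind [mpartial]. The Gevrey norm speaks of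
    multi-indices only, whereas the chain and Leibniz rules produce derivatives in any order. *)
Lemma partials_mpartial l x : O x -> partials l h x =
  mpartial [ffun i => count_mem i l] h x.
Proof.
apply: perm_partials; apply/allP => j _ /=.
rewrite count_flatten -map_comp sumnE big_map big_enum/=.
rewrite (bigD1 j)//= big1 => [|i ij]; rewrite ffunE count_nseq/=.
  by rewrite eqxx mul1n addn0.
by rewrite (negbTE ij).
Qed.

Lemma mdeg_count l : mdeg [ffun i : 'I_m => count_mem i l] = size l.
Proof.
rewrite /mdeg; under eq_bigr do rewrite ffunE.
elim: l => [|j l IHl] /=; first by rewrite big1.
rewrite big_split/= IHl (bigD1 j)//= eqxx big1 ?addn0// => i.
by rewrite eq_sym => /negbTE ->.
Qed.

End MixedPartials.

(** * Domination by one-variable polynomials *)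

Section Domination.
Variables (R : realType) (m : nat).
Implicit Types (O : set 'rV[R]_m) (x : 'rV[R]_m) (P Q : {poly R}).

(** Cauchy's majorant relation at [x] up to order [n]. One variable suffices because Gevrey bounds
    depend on the order of a derivative alone. *)
Definition dominated (n k : nat) x (F : 'I_k -> 'rV[R]_m -> R) P :=
  forall l, (size l <= n)%N ->
    \sum_j `|partials l (F j) x| <= (P^`(size l)).[0].

Lemma dominatedS n k x (F : 'I_k -> 'rV[R]_m -> R) P :
  dominated n.+1 x F P <->
  \sum_j `|F j x| <= P.[0] /\
  forall i, dominated n x (fun j => partial i (F j)) P^`().
Proof.
split=> [dF|[dF dpF] l].
  split=> [|i l ln]; first exact: (dF [::]).
  have := dF (rcons l i); rewrite size_rcons derivSn => /(_ ln).
  by under eq_bigr do rewrite partials_rcons.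
case/lastP: l => [_|l i]; first exact: dF.
rewrite size_rcons derivSn => ln; have := dpF i l ln.
by under eq_bigr do rewrite -partials_rcons.
Qed.

Lemma dominatedW n k x (F : 'I_k -> 'rV[R]_m -> R) P :
  dominated n.+1 x F P -> dominated n x F P.
Proof. by move=> dF l ln; apply: dF; exact: leqW. Qed.

Lemma eq_on_dominated O n k x (F G : 'I_k -> 'rV[R]_m -> R) P :
  open O -> (forall j y, O y -> F j y = G j y) -> O x ->
  dominated n x F P -> dominated n x G P.
Proof.
move=> oO FG Ox dF l ln; rewrite (le_trans _ (dF l ln))// le_eqVlt.
apply/orP; left; apply/eqP; apply: eq_bigr => j _; congr `|_|.
by apply: (eq_on_partials _ oO) => // y Oy; rewrite FG.
Qed.

Lemma dominatedD O n k x (F G : 'I_k -> 'rV[R]_m -> R) P Q :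
  open O -> O x -> (forall j, smooth_fun O (F j)) ->
  (forall j, smooth_fun O (G j)) -> dominated n x F P -> dominated n x G Q ->
  dominated n x (fun j y => F j y + G j y) (P + Q).
Proof.
move=> oO Ox; elim: n F G P Q => [|n IHn] F G P Q sF sG dF dG.
  case=> // _; rewrite hornerD (le_trans _ (lerD (dF [::] _) (dG [::] _)))//.
  by rewrite -big_split ler_sum// => j _; exact: ler_normD.
apply/dominatedS; split.
  rewrite hornerD (le_trans _ (lerD (dF [::] _) (dG [::] _)))//.
  by rewrite -big_split ler_sum// => j _; exact: ler_normD.
move=> i; rewrite derivD; apply: (@eq_on_dominated O n k x
    (fun j y => partial i (F j) y + partial i (G j) y)) => //.
  move=> j y Oy; rewrite partialD//.
    exact: (sF j 0 [::]).
  exact: (sG j 0 [::]).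
have [_ dpF] := (dominatedS _ _ _ _).1 dF.
have [_ dpG] := (dominatedS _ _ _ _).1 dG.
apply: (IHn (fun j => partial i (F j)) (fun j => partial i (G j)));
  [| |exact: dpF|exact: dpG] => j; apply: smooth_fun_partial.
  exact: sF.
exact: sG.
Qed.

Lemma partial_sumM O i q (f g : 'I_q -> 'rV[R]_m -> R) x : O x ->
  (forall r, smooth_fun O (f r)) -> (forall r, smooth_fun O (g r)) ->
  partial i (fun y => \sum_r f r y * g r y) x
  = \sum_r partial i (f r) x * g r x + \sum_r f r x * partial i (g r) x.
Proof.
move=> Ox sf sg.
have -> : (fun y => \sum_r f r y * g r y) = \sum_r (fun y => f r y * g r y).
  by apply/funext => y; rewrite fct_sumE.
have df r : differentiable (f r) x by exact: (sf r 0 [::]).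
have dg r : differentiable (g r) x by exact: (sg r 0 [::]).
rewrite /partial derive_sum => [|r]; last first.
  by apply: diff_derivable; exact: differentiableM.
by rewrite -big_split; apply: eq_bigr => r _; exact: partialM.
Qed.

(** The l^1 operator norm of a matrix is at most its largest column norm. *)
Lemma sum_norm_mul_le k q (f : 'I_k -> 'I_q -> R) (g : 'I_q -> R) (a b : R) :
  0 <= a -> (forall r, \sum_j `|f j r| <= a) -> \sum_r `|g r| <= b ->
  \sum_j `|\sum_r f j r * g r| <= a * b.
Proof.
move=> a0 fa gb; apply: (@le_trans _ _ (\sum_j \sum_r `|f j r * g r|)).
  by rewrite ler_sum// => j _; exact: ler_norm_sum.
rewrite exchange_big (le_trans _ (ler_wpM2l a0 gb))// mulr_sumr ler_sum// => r _.
by under eq_bigr do rewrite normrM; rewrite -mulr_suml ler_wpM2r.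
Qed.

(** A matrix of functions acts on a vector of functions; bounding it column by column keeps the
    dimensions [k] and [q] out of the majorant. *)
Lemma dominatedM O n k q x (f : 'I_k -> 'I_q -> 'rV[R]_m -> R)
    (g : 'I_q -> 'rV[R]_m -> R) P Q :
  open O -> O x -> P \is a polyOver Num.nneg ->
  (forall j r, smooth_fun O (f j r)) -> (forall r, smooth_fun O (g r)) ->
  (forall r, dominated n x (f^~ r) P) -> dominated n x g Q ->
  dominated n x (fun j y => \sum_r f j r y * g r y) (P * Q).
Proof.
move=> oO Ox; elim: n f g P Q => [|n IHn] f g P Q P0 sf sg df dg;
  have base : \sum_j `|\sum_r f j r x * g r x| <= (P * Q).[0]
    by (rewrite hornerM; apply: sum_norm_mul_le;
        [rewrite -nnegrE rpred_horner// rpred0|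
         by move=> r; exact: (df r [::])|exact: (dg [::])]).
  by case.
apply/dominatedS; split=> // i; rewrite derivM.
apply: (@eq_on_dominated O n k x (fun j y =>
    \sum_r partial i (f j r) y * g r y + \sum_r f j r y * partial i (g r) y)) => //.
  by move=> j y Oy; rewrite (partial_sumM _ Oy).
have sM j : smooth_fun O (fun y => \sum_r partial i (f j r) y * g r y).
  move=> N; apply: diff_upto_sum => // r; apply: diff_uptoM => //.
    exact: (smooth_fun_partial _ (sf j r)).
  exact: sg.
have sM' j : smooth_fun O (fun y => \sum_r f j r y * partial i (g r) y).
  move=> N; apply: diff_upto_sum => // r; apply: diff_uptoM => //.
    exact: sf.
  exact: (smooth_fun_partial _ (sg r)).
apply: (dominatedD oO Ox) => //.
  apply: IHn => //.
  - exact: polyOver_deriv.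
  - by move=> j r; exact: (smooth_fun_partial _ (sf j r)).
  - by move=> r; exact: ((dominatedS _ _ _ _).1 (df r)).2.
  - exact: dominatedW.
apply: IHn => //.
- by move=> r; exact: (smooth_fun_partial _ (sg r)).
- by move=> r; exact: dominatedW.
- exact: ((dominatedS _ _ _ _).1 dg).2.
Qed.

End Domination.

(** The rule (P o Q)' = (P' o Q) Q' mirrors the chain rule, whose Jacobian product is the matrix
    product of [dominatedM]. As [Q.[0] = 0], the value of P o Q at 0 is [P.[0]], which bounds [h] at
    [G x]. *)
Lemma dominated_comp (R : realType) (m m' k n : nat)
    (G : 'rV[R]_m -> 'rV[R]_m') (O : set 'rV[R]_m) (U : set 'rV[R]_m') x
    (h : 'I_k -> 'rV[R]_m' -> R) (P Q : {poly R}) :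
  open O -> (forall y, O y -> U (G y)) ->
  (forall r, smooth_fun O (fun y => G y 0 r)) ->
  (forall j, smooth_fun U (h j)) -> O x ->
  P \is a polyOver Num.nneg -> Q \is a polyOver Num.nneg -> Q.[0] = 0 ->
  dominated n (G x) h P ->
  (forall i, dominated n x (fun r => partial i (fun y => G y 0 r)) Q^`()) ->
  dominated n x (fun j => h j \o G) (P \Po Q).
Proof.
move=> oO GOU sG sh Ox P0 Q_ge0 Q0.
elim: n h P sh P0 => [|n IHn] h P sh P0 dh dG.
  by case=> // _; rewrite horner_comp Q0; exact: (dh [::]).
apply/dominatedS; split=> [|i].
  by rewrite horner_comp Q0; exact: (dh [::]).
rewrite deriv_comp.
apply: (@eq_on_dominated _ _ O n k x (fun j y =>
  \sum_r (partial r (h j) \o G) y * partial i (fun z => G z 0 r) y)) => //.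
  by move=> j y Oy; rewrite (eq_on_partial_comp GOU sG).
have dG' i' := dominatedW (dG i').
apply: (dominatedM oO Ox _ _ _ _ (dG' i)).
- by apply: polyOver_comp => //; exact: polyOver_deriv.
- move=> j r; apply: (smooth_fun_comp oO GOU sG).
  exact: (smooth_fun_partial _ (sh j)).
- by move=> r; exact: (smooth_fun_partial _ (sG r)).
move=> r; apply: (IHn (fun j => partial r (h j)) P^`()) => //.
- by move=> j; exact: (smooth_fun_partial _ (sh j)).
- exact: polyOver_deriv.
- exact: ((dominatedS _ _ _ _).1 dh).2.
Qed.

(** * Coefficients of the dominating composition *)

Lemma sum_inv_sqr_le1 (R : realFieldType) (n : nat) :
  \sum_(i < n) (i.+2%:R ^+ 2 : R)^-1 <= 1.
Proof.
(* The stronger bound telescopes: 1/(i+2)^2 <= 1/(i+1) - 1/(i+2). *)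
suff: \sum_(i < n) (i.+2%:R ^+ 2 : R)^-1 <= 1 - n.+1%:R^-1.
  by move=> /le_trans -> //; rewrite gerBl invr_ge0.
elim: n => [|n IHn]; first by rewrite big_ord0 invr1 subrr.
rewrite big_ord_recr/= (le_trans (lerD IHn (lexx _)))//.
rewrite -subr_ge0 -[n.+2%:R]natr1 -[n.+1%:R]natr1; set x : R := n%:R.
have x0 : 0 <= x by rewrite ler0n.
have -> : 1 - (x + 1 + 1)^-1 - (1 - (x + 1)^-1 + ((x + 1 + 1) ^+ 2)^-1) =
  ((x + 1) * (x + 2) ^+ 2)^-1 by field; lra.
by rewrite invr_ge0 mulr_ge0 ?exprn_ge0 ?addr_ge0.
Qed.

(* 1/(ab) = (1/a + 1/b)/(a + b), with a = j + 2, b = N - j + 1. *)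
Lemma inv_sqr_convolution (R : realFieldType) (N : nat) :
  \sum_(j < N) (j.+2%:R ^+ 2 : R)^-1 * ((N - j).+1%:R ^+ 2)^-1
  <= 4 * (N.+1%:R ^+ 2)^-1.
Proof.
have rev : \sum_(j < N) ((N - j).+1%:R ^+ 2 : R)^-1
         = \sum_(j < N) (j.+2%:R ^+ 2)^-1.
  rewrite (reindex_inj rev_ord_inj)/=; apply: eq_bigr => j _.
  by rewrite subKn.
(* Squaring that identity costs a factor 2, by (p + q)^2 <= 2 (p^2 + q^2), and a + b = N + 3 is
   lowered to N + 1. Each of the two resulting sums is at most 1, whence 4. *)
pose b : R := 2 * (N.+1%:R ^+ 2)^-1.
apply: (@le_trans _ _ (\sum_(j < N)
   b * ((j.+2%:R ^+ 2 : R)^-1 + ((N - j).+1%:R ^+ 2)^-1))).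
  apply: ler_sum => j _.
  have EN : N.+1%:R = j.+2%:R + (N - j).+1%:R - 2 :> R.
    rewrite -natrD -natrB; last by rewrite addSn.
    by congr (_%:R); rewrite addnS 2!addSn 2!subSS subn0 subnKC// ltnW.
  rewrite /b {b}EN.
  have : 2 <= (N - j).+1%:R :> R by rewrite ler_nat ltnS subn_gt0.
  have : 2 <= j.+2%:R :> R by rewrite ler_nat.
  move: (j.+2%:R : R) ((N - j).+1%:R : R) => x y x2 y2.
  have z0 : 0 < (x + y - 2) ^+ 2 by rewrite exprn_gt0//; lra.
  have -> : (x ^+ 2)^-1 + (y ^+ 2)^-1
      = (x ^+ 2 + y ^+ 2) * ((x ^+ 2)^-1 * (y ^+ 2)^-1) by field; lra.
  rewrite mulrA ler_peMl ?mulr_ge0 ?invr_ge0 ?sqr_ge0//.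
  by rewrite mulrAC ler_pdivlMr// mul1r; have := sqr_ge0 (x - y); nra.
rewrite -mulr_sumr big_split/= rev /b.
have := sum_inv_sqr_le1 R N; set s := \sum_(_ < N) _ => s1.
have p0 : 0 <= (N.+1%:R ^+ 2 : R)^-1 by rewrite invr_ge0 exprn_ge0.
move: p0; set P := (_ ^+ 2)^-1 => p0.
rewrite (_ : 4 * P = 2 * P * 2); last by ring.
by rewrite ler_wpM2l ?mulr_ge0//; lra.
Qed.

(** Division by j! (n - j)! leaves i + 1 <= binomial(n, j), and for j > 0 this coefficient exceeds n
    - j >= i. *)
Lemma fact_convolution_le (i j n : nat) :
  (0 < j)%N -> (i + j <= n)%N -> (i.+1 * ((n - j)`! * j`!) <= n`!)%N.
Proof.
move=> j0 ijn; have jn : (j <= n)%N by exact: leq_trans (leq_addl i j) ijn.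
rewrite -(bin_fact jn) [X in (_ <= _ * X)%N]mulnC leq_mul2r; apply/orP; right.
have [k Ek] : exists k, n = (k + j)%N by exists (n - j)%N; rewrite subnK.
have ik : (i <= k)%N by rewrite -(leq_add2r j) -Ek.
apply: (@leq_ltn_trans k) => //; rewrite {}Ek.
elim: j j0 {ijn jn} => // -[|j] IHj _; first by rewrite addn1 bin1.
by rewrite addnS binS (leq_trans (IHj _))// leq_addl.
Qed.

Lemma sum_ord_delta (R : pzSemiRingType) (n k : nat) (G : nat -> R) :
  \sum_(j < n) (j == k :> nat)%:R * G j = (k < n)%:R * G k.
Proof.
under eq_bigr do rewrite mulr_natl mulrb.
by rewrite -big_mkcond big_ord1_eq mulr_natl mulrb.
Qed.

Section CompositionMajorant.
Variable R : realType.

Definition inv_sqr (n : nat) : R := (n.+1%:R ^+ 2)^-1.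

Lemma inv_sqr_gt0 n : 0 < inv_sqr n.
Proof. by rewrite invr_gt0 exprn_gt0. Qed.

(** The product expands into four sums. The three with a Kronecker delta collapse to one term each;
    the last is a convolution of [inv_sqr] with itself, absorbed by one factor 1/c since
    [4 <= c]. *)
Lemma convolution_step (tau w c T D : R) (N : nat) :
  4 <= c -> 0 <= w -> 0 <= D ->
  \sum_(j < N.+1) (tau * (j == 0 :> nat)%:R + w / c * inv_sqr j.+1) *
                  (T * (j == N :> nat)%:R + D / c * inv_sqr (N.+1 - j))
  <= tau * T * (N == 0)%:R + (tau * D + w * (T + D)) / c * inv_sqr N.+1.
Proof.
move=> c4 w0 D0; have c0 : 0 < c by exact: lt_le_trans c4.
under eq_bigr => j _.
  rewrite (_ : _ * _ =
      (j == 0 :> nat)%:R * (tau * T * (j == N :> nat)%:R)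
    + (j == 0 :> nat)%:R * (tau * D / c * inv_sqr (N.+1 - j))
    + (j == N :> nat)%:R * (w / c * T * inv_sqr j.+1)
    + w * D / c / c * (inv_sqr j.+1 * inv_sqr (N.+1 - j))); last by ring.
  over.
rewrite !big_split/= (sum_ord_delta _ _ (fun j => tau * T * (j == N)%:R)).
rewrite (sum_ord_delta _ _ (fun j => tau * D / c * inv_sqr (N.+1 - j))).
rewrite (sum_ord_delta _ _ (fun j => w / c * T * inv_sqr j.+1)).
rewrite -mulr_sumr ltnSn ltn0Sn !mul1r subn0 [0 == N]eq_sym -!addrA lerD2l.
rewrite -subr_ge0; set s := \sum_(_ < _) _.
have sc : s <= c * inv_sqr N.+1.
  rewrite (le_trans (inv_sqr_convolution R N.+1))//.
  by rewrite ler_wpM2r// ltW// inv_sqr_gt0.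
rewrite (_ : _ - _ = w * D / c / c * (c * inv_sqr N.+1 - s)).
  by rewrite mulr_ge0 ?subr_ge0// !divr_ge0 ?mulr_ge0// ltW.
by field; rewrite gt_eqF.
Qed.

Variables (b tau w S c : R) (Q : {poly R}).
Hypotheses (b0 : 0 <= b) (tau0 : 0 < tau) (w0 : 0 <= w) (twS : tau + w <= S).
Hypothesis c4 : 4 <= c.

(** With [b = alpha - 1], this is what remains of n!^alpha once a derivative is turned into a Taylor
    coefficient. *)
Let F (n : nat) : R := n`!%:R `^ b.

Let F0 n : 0 < F n. Proof. by rewrite powR_gt0// ltr0n fact_gt0. Qed.

(** [fact_convolution_le] multiplied by i! and raised to the power [b >= 0]. It removes the
    factorials from the induction on [i]. *)
Let F_convolution i j n : (0 < j)%N -> (i + j <= n)%N ->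
  F i.+1 * F j * F (n - j) <= F n * F i.
Proof.
move=> j0 ijn; rewrite /F -!powRM// -!natrM ge0_ler_powR ?nnegrE//.
rewrite ler_nat factS -!mulnA [X in (_ <= X)%N]mulnC mulnCA.
by rewrite leq_mul2l [(j`! * _)%N]mulnC fact_convolution_le// orbT.
Qed.

Hypothesis Q0 : Q`_0 = 0.
Hypothesis Q_ge0 : forall j, 0 <= Q`_j.
Hypothesis Q_le : forall j,
  tau ^+ j.+1 * Q`_j.+1
  <= F j.+1 * (tau * (j == 0)%:R + w / c * inv_sqr j.+1).

Lemma coef_expr_ge0 i n : 0 <= (Q ^+ i)`_n.
Proof.
elim: i n => [|i IHi] n; first by rewrite expr0 coef1 ler0n.
by rewrite exprS coefM sumr_ge0// => j _; rewrite mulr_ge0.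
Qed.

Lemma coef_expr_eq0 i n : (n < i)%N -> (Q ^+ i)`_n = 0.
Proof.
elim: i n => [//|i IHi] n ni; rewrite exprS coefM big_ord_recl/= Q0 mul0r add0r.
rewrite big1// => j _; rewrite IHi ?mulr0// /bump/= add1n.
rewrite (leq_trans _ (ni : (n <= i)%N))// ltn_subrL /=.
by rewrite (leq_ltn_trans _ (ltn_ord j)).
Qed.

(* After division by S ^+ i, with q = tau / S: the first term is the power
   (q t)^i itself, and the products with at least one factor (w / (c S)) e_j
   have total weight at most 1 - q^i since q + w / S <= 1. *)
Lemma coef_expr_le i n :
  tau ^+ (i + n) * F i * (Q ^+ i)`_(i + n) <=
  F (i + n) * (tau ^+ i * (n == 0)%:R + (S ^+ i - tau ^+ i) / c * inv_sqr n.+1).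
Proof.
have c0 : 0 < c by exact: lt_le_trans c4.
have S0 : 0 < S by rewrite (lt_le_trans _ twS)// ltr_pwDl.
elim: i n => [|i IHi] n.
  rewrite !add0n !expr0 subrr !mul0r addr0 mul1r coef1.
  by have [->|] := eqVneq n 0; rewrite ?mulr0// /F fact0 powR1 !mulr1.
pose X j := tau * (j == 0)%:R + w / c * inv_sqr j.+1.
pose Y j := tau ^+ i * (j == n)%:R
  + (S ^+ i - tau ^+ i) / c * inv_sqr (n.+1 - j).
have Si : 0 <= S ^+ i - tau ^+ i.
  rewrite subr_ge0 lerXn2r ?nnegrE ?(ltW S0) ?(ltW tau0)//.
  by rewrite (le_trans _ twS)// lerDl.
(* Without factorials and powers of [tau], the estimate is [convolution_step] with [T = tau ^+ i]
   and [D = S ^+ i - tau ^+ i]; then [tau + w <= S] gives tau D + w S^i <= S^(i+1) - tau^(i+1). *)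
apply: (@le_trans _ _ (F (i.+1 + n) * \sum_(j < n.+1) X j * Y j)); last first.
  rewrite ler_pM2l//; apply: le_trans (convolution_step _ _ _ c4 w0 Si) _.
  rewrite -exprS lerD2l.
  apply: ler_wpM2r; first by rewrite ltW// inv_sqr_gt0.
  apply: ler_wpM2r; first by rewrite invr_ge0 ltW.
  rewrite subrKC mulrBr -exprS addrAC lerD2r// -mulrDl exprS.
  by rewrite ler_wpM2r// exprn_ge0// ltW.
rewrite exprS coefM addSn big_ord_recl/= Q0 mul0r add0r.
under eq_bigr do rewrite /bump/= add1n subSS.
rewrite -(big_mkord xpredT (fun j => Q`_j.+1 * (Q ^+ i)`_(i + n - j))).
(* For j > n the coefficient of [Q ^+ i] is read below degree [i], where it vanishes. *)
rewrite (@big_cat_nat _ _ _ n.+1)//=; last by rewrite ltnS leq_addl.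
rewrite [X in _ + X]big_nat_cond [X in _ + X]big1 => [|j]; last first.
  rewrite andbT => /andP[nj jin]; rewrite coef_expr_eq0 ?mulr0//.
  by rewrite ltn_subLR// addnC ltn_add2r.
rewrite addr0 big_mkord !mulr_sumr; apply: ler_sum => -[j /= jn] _.
rewrite ltnS in jn.
(* The extra [F i] completes the induction hypothesis on the left and the bound of [F_convolution]
   on the right. *)
rewrite -(ler_pM2l (F0 i)) -addnBA// /X /Y subSn//.
have -> : (j == n) = (n - j == 0)%N by rewrite subn_eq0 eqn_leq jn.
set X' := _ + _ in X *; set Y' := (X in X' * X).
have X0 : 0 <= X'.
  by rewrite addr_ge0// mulr_ge0// ?divr_ge0// ltW// inv_sqr_gt0.
have Y0 : 0 <= Y'.
  by rewrite addr_ge0// mulr_ge0// ?exprn_ge0 ?divr_ge0// ltW// inv_sqr_gt0.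
apply: (@le_trans _ _ (F i.+1 * ((F j.+1 * X') * (F (i + (n - j)) * Y')))).
  rewrite (_ : (i + n).+1 = (j.+1 + (i + (n - j))))%N; last first.
    by rewrite addSn addnCA subnKC.
  rewrite exprD (_ : F i * _ = F i.+1 * ((tau ^+ j.+1 * Q`_j.+1) *
     (tau ^+ (i + (n - j)) * F i * (Q ^+ i)`_(i + (n - j))))); last by ring.
  rewrite ler_pM2l// ler_pM// ?Q_le//.
    by rewrite mulr_ge0// exprn_ge0// ltW.
  by rewrite !mulr_ge0 ?coef_expr_ge0 ?exprn_ge0 ?ltW.
rewrite (_ : F i.+1 * _ = (F i.+1 * F j.+1 * F (i + (n - j))) * (X' * Y'));
  last by ring.
rewrite (_ : F i * _ = (F (i + n).+1 * F i) * (X' * Y')); last by ring.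
apply: ler_wpM2r; first exact: mulr_ge0.
have := @F_convolution i j.+1 (i + n).+1.
by rewrite subSS -addnBA//; apply=> //; rewrite addnS ltnS leq_add2l.
Qed.

(** With P normalised, the left side is n! times the n-th coefficient of P o Q. By [coef_expr_le],
    with q = tau / S and up to a common factor, the pure power contributes e_n q^n and the mixed
    terms at most e_n (1 - q^n). *)
Lemma sum_coef_expr_le n :
  n`!%:R * \sum_(i < n.+1) F i * (inv_sqr i / S ^+ i) * (Q ^+ i)`_n
  <= n`!%:R `^ (b + 1) / tau ^+ n * inv_sqr n.
Proof.
have c0 : 0 < c by exact: lt_le_trans c4.
have S0 : 0 < S by rewrite (lt_le_trans _ twS)// ltr_pwDl.
have tS : tau <= S by rewrite (le_trans _ twS)// lerDl.
have tn : 0 < tau ^+ n by rewrite exprn_gt0.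
rewrite powRD; last by rewrite pnatr_eq0 -lt0n fact_gt0 implybT.
rewrite powRr1// [_ * n`!%:R]mulrC -!mulrA ler_pM2l ?ltr0n ?fact_gt0//.
rewrite -/(F n) mulrCA -ler_pdivrMl ?invr_gt0// invrK mulr_sumr.
apply: (@le_trans _ _ (\sum_(i < n.+1) F n * inv_sqr i *
   ((tau / S) ^+ i * (n - i == 0)%N%:R
    + (1 - (tau / S) ^+ i) / c * inv_sqr (n - i).+1))).
  apply: ler_sum => -[i /= /[!ltnS] ni] _.
  have := coef_expr_le i (n - i); rewrite subnKC// => le_i.
  rewrite (_ : tau ^+ n * _
    = inv_sqr i / S ^+ i * (tau ^+ n * F i * (Q ^+ i)`_n));
    last by ring.
  have iS : 0 < inv_sqr i / S ^+ i by rewrite divr_gt0 ?inv_sqr_gt0 ?exprn_gt0.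
  rewrite (le_trans (ler_wpM2l (ltW iS) le_i))// le_eqVlt; apply/orP; left.
  apply/eqP; rewrite expr_div_n; field.
  by rewrite !gt_eqF ?exprn_gt0.
set q := tau / S.
have q0 : 0 <= q by rewrite divr_ge0// ltW.
have q1 : q <= 1 by rewrite ler_pdivrMr// mul1r.
have dq i : (i <= n)%N -> 0 <= 1 - q ^+ i <= 1 - q ^+ n.
  move=> ni; rewrite subr_ge0 exprn_ile1//= lerD2l lerN2 -(subnKC ni) exprD.
  by rewrite ler_piMr ?exprn_ge0// exprn_ile1.
under eq_bigr do rewrite -mulrA.
rewrite -mulr_sumr ler_pM2l//.
under eq_bigr do rewrite mulrDr.
rewrite big_split/= big_ord_recr/= subnn eqxx mulr1 big1 ?add0r; last first.
  by move=> i _; rewrite subn_eq0 leqNgt ltn_ord !mulr0.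
(* The term [i = 0] vanishes because 1 - q^0 = 0; what remains has the form of
   [inv_sqr_convolution]. *)
rewrite big_ord_recl/= expr0 subrr !mul0r mulr0 add0r.
apply: (@le_trans _ _ (inv_sqr n * q ^+ n
   + (1 - q ^+ n) / c * \sum_(i < n) inv_sqr i.+1 * inv_sqr (n - i))).
  rewrite lerD2l mulr_sumr; apply: ler_sum => i _; rewrite /bump/= add1n.
  rewrite subnSK// mulrCA; apply: ler_wpM2r.
    by rewrite mulr_ge0// ltW// inv_sqr_gt0.
  by rewrite ler_pM2r ?invr_gt0//; case/andP: (dq i.+1 (ltn_ord i)).
have /andP[dn _] := dq n (leqnn n).
apply: (@le_trans _ _ (inv_sqr n * q ^+ n
   + (1 - q ^+ n) / c * (c * inv_sqr n))).
  rewrite lerD2l; apply: ler_wpM2l; first by rewrite divr_ge0// ltW.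
  rewrite (le_trans (inv_sqr_convolution R n))//.
  by apply: ler_wpM2r => //; rewrite ltW// inv_sqr_gt0.
by rewrite mulrA divfK ?gt_eqF// [_ * q ^+ n]mulrC -mulrDl subrKC mul1r.
Qed.

End CompositionMajorant.

Lemma derivn_horner0 (R : nzSemiRingType) (P : {poly R}) n :
  (P^`(n)).[0] = P`_n *+ n`!.
Proof. by rewrite horner_coef0 coef_derivn addn0 ffactnn. Qed.

(** * The Gevrey estimate for a composition on Euclidean space *)

Section GevreyComposition.
Variables (R : realType) (m m' k : nat) (G : 'rV[R]_m -> 'rV[R]_m').
Variables (O : set 'rV[R]_m) (U : set 'rV[R]_m') (h : 'I_k -> 'rV[R]_m' -> R).
Hypotheses (oO : open O) (GOU : forall y, O y -> U (G y)).
Hypothesis sG : forall r, smooth_fun O (fun y => G y 0 r).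
Hypothesis sh : forall j, smooth_fun U (h j).
Variables (alpha S tau w c N0 : R) (x : 'rV[R]_m).
Hypotheses (alpha1 : 1 <= alpha) (tau0 : 0 < tau) (w0 : 0 <= w).
Hypotheses (twS : tau + w <= S) (c4 : 4 <= c) (N0_ge0 : 0 <= N0) (Ox : O x).

(** The bound that a norm equal to 4 pi^2 / 3 puts on derivatives of order [n]; here [s] stands for
    the alpha-th power of the Gevrey width. *)
Definition gevrey_bound (s : R) (n : nat) : R :=
  n`!%:R `^ alpha / s ^+ n * inv_sqr R n.

Hypothesis dh : forall l, \sum_j `|partials l (h j) (G x)|
  <= N0 * gevrey_bound S (size l).
Hypothesis dG : forall i l,
  \sum_r `|partials l (partial i (fun y => G y 0 r)) x|
  <= (size l == 0)%:R + w / c * gevrey_bound tau (size l).+1.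

(** Taylor coefficients of the majorants: the bounds of [dh] and [dG] divided by the factorial,
    which lowers alpha by one. In [coefQ] the factor [tau] on the delta cancels [tau ^+ 1], leaving
    the derivative 1 of the identity. *)
Let coefP i : R := N0 * (i`!%:R `^ (alpha - 1) / S ^+ i * inv_sqr R i).
Let coefQ j : R := if j is j'.+1 then j`!%:R `^ (alpha - 1) / tau ^+ j *
  (tau * (j' == 0)%:R + w / c * inv_sqr R j) else 0.

Lemma gevrey_comp_bound l : \sum_j `|partials l (h j \o G) x|
  <= N0 * gevrey_bound tau (size l).
Proof.
set n := size l.
have S0 : 0 < S by rewrite (lt_le_trans _ twS)// ltr_pwDl.
have c0 : 0 < c by exact: lt_le_trans c4.
have b0 : 0 <= alpha - 1 by rewrite subr_ge0.
have factE i : i`!%:R `^ (alpha - 1) *+ i`! = i`!%:R `^ alpha :> R.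
  rewrite -mulr_natl mulr_powRB1//; first by rewrite (lt_le_trans ltr01).
have coefP_ge0 i : 0 <= coefP i.
  rewrite !mulr_ge0 ?powR_ge0 ?invr_ge0 ?exprn_ge0// ltW//.
have coefQ_ge0 j : 0 <= coefQ j.
  case: j => //= j; rewrite mulr_ge0 ?divr_ge0 ?powR_ge0 ?exprn_ge0 ?addr_ge0//.
  - by rewrite ltW.
  - by rewrite mulr_ge0// ltW.
  - by rewrite mulr_ge0 ?divr_ge0 ?exprn_ge0// ltW// inv_sqr_gt0.
pose P := \poly_(i < n.+1) coefP i.
(* [Q] is cut one degree higher than [P], since its derivative must dominate up to order [n]. *)
pose Q := \poly_(j < n.+2) coefQ j.
have Q_ge0 j : 0 <= Q`_j by rewrite coef_poly; case: ifP.
have Q0 : Q`_0 = 0 by rewrite coef_poly.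
have P_nneg : P \is a polyOver Num.nneg.
  by apply/polyOverP => i; rewrite coef_poly nnegrE; case: ifP.
have Q_nneg : Q \is a polyOver Num.nneg by apply/polyOverP => j; rewrite nnegrE.
have domP : dominated n (G x) h P.
  move=> l' l'n; rewrite (le_trans (dh l'))// derivn_horner0 coef_poly ltnS l'n.
  rewrite /coefP /gevrey_bound -mulrnAr -!mulrnAl factE.
  by rewrite le_eqVlt eqxx.
have domQ i : dominated n x (fun r => partial i (fun y => G y 0 r)) Q^`().
  move=> l' l'n; rewrite (le_trans (dG i l'))// -derivSn derivn_horner0.
  rewrite coef_poly 2!ltnS l'n /coefQ -!mulrnAl factE mulrDr /gevrey_bound.
  rewrite mulrCA lerD2r; case: (size l') => [|r]; last by rewrite !mulr0.
  by rewrite factS fact0 muln1 powR1 expr1 !mulr1 mul1r mulVf// gt_eqF.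
have := dominated_comp oO GOU sG sh Ox P_nneg Q_nneg _ domP domQ.
move=> /(_ _ l (leqnn _)); rewrite horner_coef0 Q0 => /(_ erefl).
move=> /le_trans; apply.
rewrite derivn_horner0 comp_polyE coef_sum -/n.
have Q_le j : tau ^+ j.+1 * Q`_j.+1
  <= j.+1`!%:R `^ (alpha - 1) * (tau * (j == 0)%:R + w / c * inv_sqr R j.+1).
  rewrite (_ : _ * (_ + _) = tau ^+ j.+1 * coefQ j.+1); last first.
    by rewrite /coefQ -[in RHS]mulrA mulrCA mulVKf// gt_eqF// exprn_gt0.
  rewrite coef_poly; case: ifP => // _.
  by rewrite mulr0 mulr_ge0// exprn_ge0// ltW.
have := sum_coef_expr_le b0 tau0 w0 twS c4 Q0 Q_ge0 Q_le n.
rewrite subrK => le_n.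
rewrite (le_trans _ (ler_wpM2l N0_ge0 le_n))// le_eqVlt; apply/orP; left.
apply/eqP.
(* [size P] can be less than [n.+1]; the missing coefficients of [P] are 0. *)
have -> : \sum_(i < size P) (P`_i *: Q ^+ i)`_n
        = \sum_(i < n.+1) P`_i * (Q ^+ i)`_n.
  rewrite (big_ord_widen n.+1 (fun i => (P`_i *: Q ^+ i)`_n)) ?size_poly//.
  rewrite big_mkcond; apply: eq_bigr => i _.
  case: ifPn => [_|]; first by rewrite coefZ.
  by rewrite -leqNgt => /(nth_default 0) ->; rewrite mul0r.
rewrite -[LHS]mulr_natl mulrCA; congr (_ * _).
rewrite mulr_sumr; apply: eq_bigr => i _.
by rewrite coef_poly ltn_ord /coefP -mulrA [S ^- i * _]mulrC [RHS]mulrA.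
Qed.

End GevreyComposition.

(** * Extending the composition on the cylinder *)

Section CoverTopology.
Variables (R : realType) (m1 m2 : nat).
Local Notation X := (torus R m1 * 'rV[R]_m2)%type.

Lemma cover_continuous : continuous (@cover R m1 m2).
Proof.
have cl : continuous (@torus_pi R m1 \o (lsubmx : 'rV_(m1 + m2) -> 'rV_m1)
    : _ -> torus R m1).
  move=> x; apply: continuous_comp; first exact: continuous_lsubmx.
  exact: pi_continuous.
move=> x W [[A B] /= [nA nB] AB].
have nA' := cl x _ nA; have nB' := @continuous_rsubmx R 1 m1 m2 x _ nB.
have F := @nbhs_filter 'rV[R]_(m1 + m2) x.
apply: (@filterS _ _ F _ _ _ (@filterI _ _ F _ _ nA' nB')) => y [Ay By].
exact: (AB (_, _)).
Qed.

Lemma open_preimage_cover (U : set X) : open U -> open (@cover R m1 m2 @^-1` U).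
Proof. by apply: open_comp => x _; exact: cover_continuous. Qed.

Lemma row_mx_continuous :
  continuous (fun z : 'rV[R]_m1 * 'rV[R]_m2 => row_mx z.1 z.2).
Proof.
move=> [r y] A [P nP PA].
exists ([set r' : 'rV_m1 | forall i j, P i (lshift m2 j) (r' i j)],
        [set y' : 'rV_m2 | forall i j, P i (rshift m1 j) (y' i j)]) => /=.
  split.
    exists (fun i j => P i (lshift m2 j)) => // i j.
    by have := nP i (lshift m2 j); rewrite /= row_mxEl.
  exists (fun i j => P i (rshift m1 j)) => // i j.
  by have := nP i (rshift m1 j); rewrite /= row_mxEr.
move=> [r' y'] [/= Pr Py]; apply: PA => i j.
by rewrite -[j]splitK; case: (fintype.split j) => k /=;
  rewrite ?row_mxEl ?row_mxEr.
Qed.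

(** The preimage of the image is the union of the integer translates of [A]: near [x] congruent to
    [a] in [A], translation by [a - x] leads into [A]. *)
Lemma open_torus_pi (A : set 'rV[R]_m1) : open A -> open (@torus_pi R m1 @` A).
Proof.
move=> oA; rewrite /open/= /quotient_open openE => x /= [a Aa ax].
have ca : continuous (fun z : 'rV[R]_m1 => z + (a - x)).
  by move=> z; apply: (@cvgD _ _ _ (nbhs z)); [exact: cvg_id|exact: cvg_cst].
have : nbhs (x + (a - x)) A by apply: open_nbhs_nbhs; split; rewrite ?subrKC.
move=> /ca; have F := @nbhs_filter 'rV[R]_m1 x.
apply: (@filterS _ _ F) => z Az; exists (z + (a - x)) => //.
apply/eqmodP/forallP => i; move/eqmodP/forallP: ax => /(_ i); rewrite !mxE.
by rewrite addrAC subrr add0r.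
Qed.

(** [X] carries a product topology with a quotient as first factor; it agrees with the quotient
    topology of [cover] because [torus_pi] is open. *)
Lemma open_cover_preimage (W : set X) : open (@cover R m1 m2 @^-1` W) -> open W.
Proof.
move=> oW; rewrite openE => -[t y] Wty.
have cty : cover (row_mx (repr t) y) = (t, y) := cover_reprK (t, y).
have : nbhs (row_mx (repr t) y) (@cover R m1 m2 @^-1` W).
  by apply: open_nbhs_nbhs; split => //; rewrite /preimage/= cty.
move=> /(@row_mx_continuous (repr t, y))[[A B] /= [nA nB] AB].
exists (@torus_pi R m1 @` A^°, B) => /=.
  split => //; apply: (@open_nbhs_nbhs (torus R m1)); split.
    by apply: open_torus_pi; exact: open_interior.
  by exists (repr t); [exact: nA|exact: reprK].
move=> [t' y'] /= [[r rA <-] By'].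
have := AB (r, y') (conj (interior_subset rA) By').
by rewrite /= /cover row_mxKl row_mxKr.
Qed.

End CoverTopology.

Lemma partial_coord (R : realType) (m : nat) (i r : 'I_m) :
  partial i (fun x : 'rV[R]_m => x 0 r) = fun=> (r == i)%:R.
Proof.
apply/funext => x; rewrite /partial.
have /rowP/(_ r) :=
  @derive_mx _ _ 1 m id x (delta_mx 0 i) (@derivable_id _ _ _ _).
by rewrite derive_id !mxE eqxx /= => <-.
Qed.

Lemma smooth_fun_coord (R : realType) (m : nat) (O : set 'rV[R]_m) (r : 'I_m) :
  smooth_fun O (fun x => x 0 r).
Proof.
case=> [|n]; first by case=> // x _ _; exact: differentiable_coord.
apply/diff_uptoS; split=> [x _|i]; first exact: differentiable_coord.
by rewrite partial_coord; exact: diff_upto_cst.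
Qed.

Section SmoothComposition.
Variables (R : realType) (m1 m2 p : nat).
Local Notation X := (torus R m1 * 'rV[R]_m2)%type.
Local Notation V := 'rV[R]_(m1 + m2).

(** The lift of Id + v to the universal cover. *)
Definition shift_by (v : X -> V) (x : V) : V := x + v (cover x).

(* The extension of f o g when F and v extend f and u. *)
Definition comp_shift (F : X -> 'rV[R]_p) (v : X -> V) : X -> 'rV[R]_p :=
  fun a => F (cover (cover_repr a + v a)).

(** [x] and the chosen representative of [cover x] differ by an integer vector in the torus block,
    invisible to [cover]. *)
Lemma cover_shift_by v x :
  cover (cover_repr (cover x) + v (cover x)) = cover (shift_by v x).
Proof.
have -> : cover_repr (cover x) + v (cover x)
        = x + v (cover x) + (cover_repr (cover x) - x).
  by rewrite [x + _]addrC -addrA subrKC addrC.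
by rewrite cover_eqP// cover_reprK.
Qed.

Lemma lift_comp_shift F v j :
  lift_coord (comp_shift F v) j = lift_coord F j \o shift_by v.
Proof.
by apply/funext => x; rewrite /lift_coord /comp_shift cover_shift_by.
Qed.

Lemma smooth_shift_by (U : set X) (v : X -> V) r : open U -> smooth_on U v ->
  smooth_fun (@cover R m1 m2 @^-1` U) (fun x => shift_by v x 0 r).
Proof.
move=> oU sv n; rewrite /shift_by.
apply: (@eq_on_diff_upto _ _ n (@cover R m1 m2 @^-1` U)
  (fun x => x 0 r + lift_coord v r x)).
- exact: open_preimage_cover.
- by move=> x _; rewrite mxE.
apply: diff_uptoD.
- exact: open_preimage_cover.
- exact: smooth_fun_coord.
- by move=> l x _ Ux; exact: sv.
Qed.

Lemma partials_shift_by (U : set X) (v : X -> V) i r l x :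
  open U -> smooth_on U v -> U (cover x) ->
  partials l (partial i (fun x => shift_by v x 0 r)) x
  = (size l == 0)%:R * (r == i)%:R + partials (rcons l i) (lift_coord v r) x.
Proof.
move=> oU sv; have oU' := open_preimage_cover oU.
have E y : U (cover y) -> partial i (fun x => shift_by v x 0 r) y
    = (r == i)%:R + partial i (lift_coord v r) y.
  move=> Uy; have -> : (fun x => shift_by v x 0 r)
    = (fun x => x 0 r + lift_coord v r x) by apply/funext => z; rewrite mxE.
  rewrite partialD; last exact: (sv r [::]).
    by rewrite partial_coord.
  exact: differentiable_coord.
move=> Ux; rewrite (eq_on_partials _ oU' E Ux) partials_rcons.
case/lastP: l => [|l k]; first by rewrite mul1r.
rewrite size_rcons mul0r add0r !partials_rcons.
apply: (eq_on_partials _ oU' _ Ux) => y Uy.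
rewrite partialD; last exact: (sv r [:: i]).
  by rewrite partial_cst add0r.
exact: differentiable_cst.
Qed.

Lemma open_shift_by (U : set X) (UF : set X) (v : X -> V) : open U -> open UF ->
  smooth_on U v ->
  open [set x : V | U (cover x) /\ UF (cover (shift_by v x))].
Proof.
move=> oU oUF sv; rewrite openE => x /= [Ux UFx].
have nU : nbhs x (@cover R m1 m2 @^-1` U).
  by apply: cover_continuous; apply: open_nbhs_nbhs.
have cx : {for x, continuous (shift_by v)}.
  apply/differentiable_continuous/differentiable_row => r.
  exact: (diff_upto0 (@smooth_shift_by U v r oU sv 0)).
have nF : nbhs x (shift_by v @^-1` (@cover R m1 m2 @^-1` UF)).
  by apply: cx; apply: cover_continuous; apply: open_nbhs_nbhs.
exact: filterI nU nF.
Qed.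

End SmoothComposition.

(** * Gevrey norms *)

Lemma gevrey_const_ge4 (R : realType) : 4 <= 4 * pi ^+ 2 / 3 :> R.
Proof. by have := pi_ge2 R => pi2; rewrite ler_pdivlMr//; nra. Qed.

(** A fraction r in (0, 1] satisfies r^a <= r; this is applied to x/(x+y) and y/(x+y). With s -
    sigma and sigma it yields tau + w <= S. *)
Lemma powR_superadd (R : realType) (a x y : R) : 1 <= a -> 0 < x -> 0 < y ->
  x `^ a + y `^ a <= (x + y) `^ a.
Proof.
move=> a1 x0 y0; have xy0 : 0 < x + y by rewrite addr_gt0.
have le z : 0 < z -> z <= x + y -> z `^ a <= z / (x + y) * (x + y) `^ a.
  move=> z0 zxy; rewrite -[in leLHS](divfK (lt0r_neq0 xy0) z).
  apply: ge1r_powRZ => //; last exact: ltW.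
  by rewrite divr_gt0//= ler_pdivrMr// mul1r.
have xle : x <= x + y by rewrite lerDl ltW.
have yle : y <= x + y by rewrite lerDr ltW.
apply: le_trans (lerD (le x x0 xle) (le y y0 yle)) _.
by rewrite -!mulrDl divff ?mul1r// lt0r_neq0.
Qed.

Lemma mpartial_partials (R : realType) (m : nat) (k : {ffun 'I_m -> nat}) :
  exists2 l, size l = mdeg k &
    forall h : 'rV[R]_m -> R, mpartial k h = partials l h.
Proof.
exists (flatten [seq nseq (k i) i | i <- enum 'I_m]) => //.
rewrite size_flatten /shape -map_comp sumnE big_map big_enum/=.
by apply: eq_bigr => i _; rewrite size_nseq.
Qed.

Section GevreyNorm.
Variables (R : realType) (m1 m2 p : nat) (alpha s : R).
Local Notation X := (torus R m1 * 'rV[R]_m2)%type.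
Local Notation c := (4 * pi ^+ 2 / 3 : R).
Hypothesis s0 : 0 < s.

Lemma gevrey_norm_leP (K : set X) (f : X -> 'rV[R]_p) (M : R) :
  (gevrey_norm alpha s K f <= M%:E)%E <->
  forall a k, K a ->
    dnorm K f k a <= M / c * gevrey_bound alpha (s `^ alpha) (mdeg k).
Proof.
have c0 : 0 < c by rewrite (lt_le_trans _ (gevrey_const_ge4 R)).
have bound_equiv a k :
    ((mdeg k).+1%:R ^+ 2 * s `^ (alpha * (mdeg k)%:R) * dnorm K f k a)
           / ((mdeg k)`!%:R `^ alpha) <= M / c <->
    dnorm K f k a <= M / c * gevrey_bound alpha (s `^ alpha) (mdeg k).
  rewrite /gevrey_bound /inv_sqr powRrM powR_mulrn ?powR_ge0//.
  rewrite ler_pdivrMr ?powR_gt0 ?ltr0n ?fact_gt0// mulrC -ler_pdivlMr; last first.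
    by rewrite mulr_gt0 ?exprn_gt0 ?powR_gt0.
  have E (F T q : R) : M / c * F / (T * q) = M / c * (F / q / T).
    by rewrite (invfM T) [T^-1 * _]mulrC !mulrA.
  by rewrite E.
rewrite /gevrey_norm muleC -lee_pdivlMr// -EFinM; split.
  move=> /ereal_supP nle a k Ka; apply/bound_equiv; rewrite -lee_fin.
  apply: le_trans (nle _ (ex_intro2 _ _ a Ka erefl)).
  by apply: ereal_sup_ubound; exists k.
move=> nle; apply/ereal_supP => _ [a Ka <-]; apply/ereal_supP => _ [k _ <-].
by rewrite lee_fin; apply/bound_equiv; exact: nle.
Qed.

(** The multi-index 0 at [a] already gives a nonnegative term; over an empty [K] the supremum would
    be -oo. *)
Lemma gevrey_norm_ge0 (K : set X) (f : X -> 'rV[R]_p) (a : X) :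
  K a -> (0 <= gevrey_norm alpha s K f)%E.
Proof.
move=> Ka; apply: mule_ge0.
  by rewrite lee_fin (le_trans _ (gevrey_const_ge4 R)).
apply: le_trans (ereal_sup_ubound (ex_intro2 _ _ a Ka erefl)).
apply: le_trans (ereal_sup_ubound (ex_intro2 _ _ [ffun=> 0%N] I erefl)).
by rewrite lee_fin divr_ge0 ?mulr_ge0 ?exprn_ge0 ?powR_ge0 ?sumr_ge0.
Qed.

End GevreyNorm.

(** * The composition estimate on the cylinder *)

Lemma dnorm_mpartial (R : realType) (m1 m2 p : nat) (B : set 'rV[R]_m2)
    (f F : torus R m1 * 'rV[R]_m2 -> 'rV[R]_p) k (x : 'rV[R]_(m1 + m2)) :
  open B -> smooth_extension (cyl m1 (closure B)) f F ->
  cyl m1 (closure B) (cover x) ->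
  dnorm (cyl m1 (closure B)) f k (cover x)
  = \sum_j `|mpartial k (lift_coord F j) x|.
Proof.
by move=> oB fF Kx; apply: eq_bigr => j _; rewrite (dpart_ext _ _ oB fF).
Qed.

(** The norm controls one ordering of each derivative on one chosen extension; commuting partials
    and [dpart_ext] carry the bound to every ordering and to [F]. *)
Lemma sum_partials_le (R : realType) (m1 m2 p : nat) (alpha s M : R)
    (B : set 'rV[R]_m2) (f F : torus R m1 * 'rV[R]_m2 -> 'rV[R]_p)
    (x : 'rV[R]_(m1 + m2)) l :
  0 < s -> open B -> smooth_extension (cyl m1 (closure B)) f F ->
  (gevrey_norm alpha s (cyl m1 (closure B)) f <= M%:E)%E ->
  cyl m1 (closure B) (cover x) ->
  \sum_j `|partials l (lift_coord F j) x|
  <= M / (4 * pi ^+ 2 / 3) * gevrey_bound alpha (s `^ alpha) (size l).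
Proof.
move=> s0 oB fF /gevrey_norm_leP nle Kx.
have [U [oU KU sF _]] := fF.
have := nle s0 (cover x) [ffun i => count_mem i l] Kx.
rewrite (dnorm_mpartial _ oB fF Kx) mdeg_count; apply: le_trans.
rewrite le_eqVlt; apply/orP; left; apply/eqP; apply: eq_bigr => j _.
congr `|_|; apply: (partials_mpartial (open_preimage_cover oU)) => //.
  by move=> n l' y _; exact: sF.
exact: KU.
Qed.

Theorem proposition20 (R : realType) (m1 m2 p : nat) (alpha s sigma : R)
  (B B' : set 'rV[R]_m2)
  (f : torus R m1 * 'rV[R]_m2 -> 'rV[R]_p)
  (g : torus R m1 * 'rV[R]_m2 -> torus R m1 * 'rV[R]_m2)
  (u : torus R m1 * 'rV[R]_m2 -> 'rV[R]_(m1 + m2)) :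
  let K := cyl m1 (closure B) in
  let L := cyl m1 (closure B') in
  1 <= alpha -> 0 < sigma -> sigma < s -> (1 <= p)%N ->
  open B -> open B' -> compact K -> compact L ->
  gevrey alpha s K f ->
  Id_plus L u g ->
  gevrey alpha (s - sigma) L u ->
  g @` L `<=` K ->
  (gevrey_norm alpha (s - sigma) L u <= (sigma `^ alpha)%:E)%E ->
  gevrey alpha (s - sigma) L (f \o g) /\
  (gevrey_norm alpha (s - sigma) L (f \o g) <= gevrey_norm alpha s K f)%E.
Proof.
move=> K L alpha1 sig0 ss _ oB oB' _ _ [[F fF] nf] gu [[v uv] _] gLK nu.
have [UF [oUF KUF sF Ff]] := fF; have [Uv [oUv LUv sv vu]] := uv.
(* On [O] the extension [v] is smooth and the lifted map lands where [F] is smooth. *)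
pose O := [set x | Uv (cover x) /\ UF (cover (shift_by v x))].
have oO : open O by exact: open_shift_by.
have gE x : L (cover x) -> g (cover x) = cover (shift_by v x).
  by move=> Lx; rewrite gu// /shift_by vu// inE.
have GK x : L (cover x) -> K (cover (shift_by v x)).
  by move=> Lx; rewrite -gE//; apply: gLK; exists (cover x).
have sG r : smooth_fun O (fun x => shift_by v x 0 r).
  move=> n l x ln [Ux _].
  exact: (@smooth_shift_by _ _ _ _ _ r oUv sv n l x ln Ux).
have sFl j : smooth_fun (@cover R m1 m2 @^-1` UF) (lift_coord F j).
  by move=> n l x _ UFx; exact: sF.
have OU x : O x -> UF (cover (shift_by v x)) by case.
have LO x : L (cover x) -> O x.
  by move=> Lx; split; [exact: LUv|apply: KUF; exact: GK].
have fgH : smooth_extension L (f \o g) (comp_shift F v).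
  (* [W] is [O] seen on the cylinder; its preimage under [cover] is [O], so it is open. *)
  pose W := [set a | Uv a /\ UF (cover (cover_repr a + v a))].
  have WO : @cover R m1 m2 @^-1` W = O.
    by apply/funext => x; rewrite /W /O /preimage/= cover_shift_by.
  exists W; split.
  - by apply: open_cover_preimage; rewrite WO.
  - move=> a La; have := LO (cover_repr a).
    by rewrite -WO /preimage/= cover_reprK; apply.
  - move=> j l x Wx; rewrite lift_comp_shift.
    have Ox : O x by rewrite -WO.
    exact: (smooth_fun_comp oO OU sG (sFl j) (leqnn _) Ox).
  - move=> a /[!inE] La.
    have Lx : L (cover (cover_repr a)) by rewrite cover_reprK.
    have := gE _ Lx; have := GK _ Lx.
    by rewrite /comp_shift /shift_by cover_reprK /= => Ka ->; rewrite Ff ?inE.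
suff le_norm : (gevrey_norm alpha (s - sigma) L (f \o g)
    <= gevrey_norm alpha s K f)%E.
  split; last exact: le_norm.
  by split; [exists (comp_shift F v)|exact: le_lt_trans nf].
have tau0 : 0 < s - sigma by rewrite subr_gt0.
have s0 : 0 < s by exact: lt_trans sig0 ss.
(* For empty [L] the norm on the left is -oo. Otherwise [g a0] is a point of [K], so the norm of [f]
   is nonnegative, hence a real number [M]. *)
have [L0|/set0P[a0 La0]] := eqVneq L set0.
  rewrite /gevrey_norm L0 image_set0 ereal_sup0.
  by rewrite mulrNy gtr0_sg ?mul1e ?leNye//
    (lt_le_trans _ (gevrey_const_ge4 R)).
have Kg0 : K (g a0) by apply: gLK; exists a0.
have nf0 := gevrey_norm_ge0 alpha s f Kg0.
have nfE : (fine (gevrey_norm alpha s K f))%:E = gevrey_norm alpha s K f.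
  by rewrite fineK// ge0_fin_numE.
set M := fine _ in nfE; rewrite -nfE; apply/gevrey_norm_leP => // a k La.
have Lx : L (cover (cover_repr a)) by rewrite cover_reprK.
rewrite -{1}(cover_reprK a) (dnorm_mpartial _ oB' fgH)//.
have [l <- lE] := mpartial_partials R k.
under eq_bigr do rewrite lE lift_comp_shift.
(* S, tau and w are the alpha-th powers of s, s - sigma and sigma; [N0] is [M] divided by 4 pi^2 /
   3. *)
apply: (@gevrey_comp_bound _ _ _ _ _ O _ _ oO OU sG sFl alpha (s `^ alpha)
  ((s - sigma) `^ alpha) (sigma `^ alpha) (4 * pi ^+ 2 / 3)) => //.
- exact: powR_gt0.
- exact: powR_ge0.
- by rewrite -[s in leRHS](subrK sigma) powR_superadd.
- exact: gevrey_const_ge4.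
- by rewrite divr_ge0 ?fine_ge0// (le_trans _ (gevrey_const_ge4 R)).
- exact: LO.
- have nfM : (gevrey_norm alpha s K f <= M%:E)%E by rewrite nfE.
  by move=> l'; exact: sum_partials_le l' s0 oB fF nfM (GK _ Lx).
- move=> i l'; have Uvx := LUv _ Lx.
  under eq_bigr do rewrite (partials_shift_by _ _ _ oUv sv Uvx).
  (* Summed over the components, the identity contributes its single diagonal entry 1 at first
     order; the rest is the bound on [u], with norm at most w. *)
  rewrite (le_trans (ler_sum _ (fun r _ => ler_normD _ _)))//.
  rewrite big_split/= lerD//.
    under eq_bigr do rewrite normrM !normr_nat.
    rewrite -mulr_sumr (bigD1 i)//= eqxx big1 ?addr0 ?mulr1// => r.
    by move=> /negbTE ->.
  have := sum_partials_le (rcons l' i) tau0 oB' uv nu Lx.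
  by rewrite size_rcons.
Qed.
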